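(* Let $I$ be a problem with agents $N$, contracts $E$, participants $P(e)$ and Plott choice functions $C_a$ on $E(a)$, and suppose: (1) $N=M\sqcup W$ and agents of $W$ are not connected to each other, i.e. $|P(e)\cap W|\le 1$ for every $e\in E$; (2) for each $w\in W$, $C_w=C_{w(1)}*\cdots*C_{w(q_w)}$ where each $C_{w(j)}$ is a Plott choice function on $E(w)$; (3) $C_m$ is a Plott choice function for every $m\in M$. Then there exist a problem $\widetilde I$ with agents $\widetilde N=\widetilde M\sqcup\widetilde W$, contracts $\widetilde E$ and Plott choice functions $\widetilde C_{\widetilde a}$, together with maps $\pi:\widetilde N\to N$ and $\pi:\widetilde E\to E$, such that: (a) $\pi$ maps $\widetilde M$ bijectively onto $M$, and for each $w\in W$ the fibre $\pi^{-1}(w)\subseteq\widetilde W$ consists of $q_w$ elements $w(1),\dots,w(q_w)$; (b) for each $w\in W$ and $j$, $\pi$ identifies the contract set $\widetilde E(w(j))$ of $w(j)$ with $E(w)$, and under this identification the choice function of $w(j)$ is $C_{w(j)}$; (c) the map $\widetilde S\mapsto\pi(\widetilde S)$ is a bijection from the set $\mathbf{St}(\widetilde I)$ of stable sets of $\widetilde I$ onto the set $\mathbf{St}(I)$ of stable sets of $I$.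
   Context: All sets are finite. A choice function (CF) on a set $X$ is a map $C:2^X\to 2^X$ with $C(A)\subseteq A$. It is a Plott CF if it is consistent ($C(A)\subseteq B\subseteq A\Rightarrow C(B)=C(A)$) and substitutable ($B\subseteq A\Rightarrow C(A)\cap B\subseteq C(B)$). For CFs $F,G$ on the same set, $(F*G)(A)=F(A)\cup G(A\setminus F(A))$; this operation is associative. A problem consists of a finite set $N$ of agents, a finite set $E$ of contracts, for each $e\in E$ a set $P(e)\subseteq N$ of participants, and for each $a\in N$ a Plott CF $C_a$ on $E(a)=\{e\in E: a\in P(e)\}$. For $S\subseteq E$ write $S(a)=S\cap E(a)$. $S$ is stable if (1) $C_a(S(a))=S(a)$ for all $a\in N$, and (2) every $e\in E$ such that $e\in C_a(S(a)\cup\{e\})$ for all $a\in P(e)$ belongs to $S$. *)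

(* Defs.v *)
From mathcomp Require Import all_boot.

Set Implicit Arguments.
Unset Strict Implicit.
Unset Printing Implicit Defensive.

(* A choice function on X : {set T} is a map on {set T} of which only the
   values at subsets of X are meaningful; accordingly every property or equality
   of choice functions on X is only required at subsets of X. *)
Section ChoiceFunction.

Variable T : finType.
Implicit Types (X A B : {set T}) (C F G : {set T} -> {set T}).

Definition choice_function X C := forall A, A \subset X -> C A \subset A.

Definition consistent X C :=
  forall A B, A \subset X -> C A \subset B -> B \subset A -> C B = C A.

Definition substitutable X C :=
  forall A B, A \subset X -> B \subset A -> C A :&: B \subset C B.

Definition plott X C :=
  [/\ choice_function X C, consistent X C & substitutable X C].

Definition cf_star F G : {set T} -> {set T} :=
  fun A => F A :|: G (A :\: F A).

(* The neutral element of cf_star, hence the value of an empty product. *)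
Definition cf0 : {set T} -> {set T} := fun=> set0.

End ChoiceFunction.

Record problem := Problem {
  agent : finType;
  contract : finType;
  part : contract -> {set agent};
  choice : agent -> {set contract} -> {set contract};
  choice_plott : forall a : agent, plott [set e | a \in part e] (choice a)
}.

Definition contracts_of (I : problem) (a : agent I) : {set contract I} :=
  [set e | a \in part e].

Definition stable (I : problem) : {set {set contract I}} :=
  [set S : {set contract I} |
    [forall a, choice a (S :&: contracts_of a) == S :&: contracts_of a]
    && [forall e, [forall a in part e,
                     e \in choice a ((S :&: contracts_of a) :|: [set e])]
                  ==> (e \in S)]].

Definition maps_bijectively (T U : finType) (f : T -> U)
    (A : {set T}) (B : {set U}) :=
  {in A &, injective f} /\ f @: A = B.

(* Main.v *)
(* Each contract e of an agent w in W gets one copy e(j) for each factor w(j) of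
   C_w, and an agent of M offered several copies of a chosen contract takes the
   one of smallest index. A set S with C_w(S) = S splits uniquely into the sets
   S_j that the factors select in turn; these are characterised by
   C_w(j)(S_j) = S_j together with the rejection of every e in S_k, k > j, by w(j)
   from S_j + e. In a stable set of the expanded problem this rejection is
   stability against e(j), since the other participants prefer e(j) to e(k).
   This needs a member of M in every contract. If M is not empty, an agent m of M
   is first added to all contracts, with a choice function that accepts all the
   contracts new to m, which does not change the stable sets. If M is empty, every
   contract has at most one participant and the stable set is unique. *)
Require Import Defs.
From mathcomp Require Import all_boot.

Set Implicit Arguments.
Unset Strict Implicit.
Unset Printing Implicit Defensive.

Local Notation cf_prod D := (\big[@cf_star _/@cf0 _]_j D j).

(** * Products of Plott functions and their greedy decompositions *)

Section Plott.

Variables (T : finType) (X : {set T}).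
Implicit Types (A B : {set T}) (C : {set T} -> {set T}).

(** By substitutability, an [e] outside [B] chosen from [A] would be chosen from [e |: B]. So [C A]
    lies in [B], and consistency applies. *)
Lemma plott_reject C A B : plott X C -> A \subset X -> B \subset A -> C B = B ->
  {in A :\: B, forall e, e \notin C (e |: B)} -> C A = B.
Proof.
move=> [cC kC sC] AX BA CB rej; rewrite -CB; apply/esym/kC => //.
apply/subsetP=> e eCA; apply: contraT => eB.
have eA : e \in A by rewrite (subsetP (cC _ AX)).
have: e \in C A :&: (e |: B) by rewrite inE eCA !inE eqxx.
have eBA : e |: B \subset A by rewrite subUset sub1set eA.
move/(subsetP (sC _ _ AX eBA)).
by rewrite (negbTE (rej e _)) // inE eB.
Qed.

Lemma plott_inter_reject C A B e : plott X C -> A \subset X -> B \subset A ->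
  e \in B -> e \notin C B -> e \notin C A.
Proof.
move=> [_ _ sC] AX BA eB; apply: contra => eCA.
by apply: (subsetP (sC _ _ AX BA)); rewrite inE eCA.
Qed.

(** Consistency is used twice: discarding the rejected [e] gives [C (e |: A) = B], and [e |: B] lies
    between [B] and [e |: A]. *)
Lemma plott_irrelevant C A B e : plott X C -> e |: A \subset X -> B \subset A ->
  C A = B -> e \notin C (e |: A) -> C (e |: B) = B.
Proof.
move=> [cC kC _] AX BA CA eN.
have eA : C (e |: A) = B.
  rewrite -CA; apply/esym/kC => //; last exact: subsetUr.
  apply/subsetP=> x xC; move: (subsetP (cC _ AX) x xC); rewrite in_setU1.
  by case: eqP => // xe; rewrite xe in xC; rewrite xC in eN.
by rewrite -{2}eA; apply: kC; rewrite ?eA ?subsetUr ?setUS.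
Qed.

(** Each condition involves a single factor and avoids the successive remainders, so that it can be
    read off stability at a copy [w(j)]. *)
Definition greedy n (D : 'I_n -> {set T} -> {set T}) (S : 'I_n -> {set T}) :=
  (forall j, D j (S j) = S j) /\
  (forall j k : 'I_n, j < k -> {in S k, forall e, e \notin D j (e |: S j)}).

Lemma greedy_tail n (D : 'I_n.+1 -> {set T} -> {set T}) S : greedy D S ->
  greedy (fun j => D (lift ord0 j)) (fun j => S (lift ord0 j)).
Proof. by case=> fixS rejS; split=> [j|j k jk]; [apply: fixS | apply: rejS]. Qed.

Lemma bigcup_lift n (S : 'I_n.+1 -> {set T}) :
  \bigcup_j S j = S ord0 :|: \bigcup_j S (lift ord0 j).
Proof. by rewrite big_ord_recl. Qed.

Lemma greedy_head_reject n (D : 'I_n.+1 -> {set T} -> {set T}) S e : greedy D S ->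
  e \in \bigcup_j S (lift ord0 j) -> e \notin D ord0 (e |: S ord0).
Proof. by move=> [_ rejS] /bigcupP[j _]; apply: rejS. Qed.

Lemma greedy_head_notin n (D : 'I_n.+1 -> {set T} -> {set T}) S e : greedy D S ->
  e \in \bigcup_j S (lift ord0 j) -> e \notin S ord0.
Proof.
move=> gS eU; apply: contra (greedy_head_reject gS eU) => eS.
by rewrite (setUidPr _) ?sub1set // gS.1.
Qed.

Lemma greedy_headD n (D : 'I_n.+1 -> {set T} -> {set T}) S : greedy D S ->
  \bigcup_j S j :\: S ord0 = \bigcup_j S (lift ord0 j).
Proof.
move=> gS; rewrite bigcup_lift; apply/setP=> e; rewrite !inE.
have := @greedy_head_notin _ _ _ e gS.
by case: (e \in \bigcup_j _) => [->|] //; case: (e \in S ord0).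
Qed.

(** Every element outside [S ord0] lies in a later set, hence is rejected by the first factor.
    Inductions on the number of factors can then pass to the tail. *)
Lemma greedy_head n (D : 'I_n.+1 -> {set T} -> {set T}) S : plott X (D ord0) ->
  greedy D S -> \bigcup_j S j \subset X -> D ord0 (\bigcup_j S j) = S ord0.
Proof.
move=> pD gS SX; apply: (plott_reject pD SX); first exact: bigcup_sup.
  exact: gS.1.
by move=> e; rewrite (greedy_headD gS); apply: greedy_head_reject.
Qed.

Lemma greedy_prod n (D : 'I_n -> {set T} -> {set T}) S : (forall j, plott X (D j)) ->
  greedy D S -> \bigcup_j S j \subset X -> cf_prod D (\bigcup_j S j) = \bigcup_j S j.
Proof.
elim: n D S => [|n IHn] D S pD gS SX; first by rewrite !big_ord0.
rewrite big_ord_recl /cf_star (greedy_head (pD _) gS SX) (greedy_headD gS) IHn -?bigcup_lift //.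
  exact: greedy_tail.
by apply: subset_trans SX; rewrite bigcup_lift subsetUr.
Qed.

(** [e] is passed down the factors until one accepts it; a factor that rejects it still selects its
    own set. *)
Lemma greedy_prod_add n (D : 'I_n -> {set T} -> {set T}) S e :
  (forall j, plott X (D j)) -> greedy D S -> e |: \bigcup_j S j \subset X ->
  (e \in cf_prod D (e |: \bigcup_j S j)) = [exists j, e \in D j (e |: S j)].
Proof.
elim: n D S => [|n IHn] D S pD gS eSX.
  by rewrite !big_ord0 inE; apply/esym/existsP=> -[[]].
have SX : \bigcup_j S j \subset X by apply: subset_trans eSX; rewrite subsetUr.
rewrite big_ord_recl /cf_star in_setU.
have [eD|eN] := boolP (e \in D ord0 (e |: S ord0)).
  have -> : [exists j, e \in D j (e |: S j)] by apply/existsP; exists ord0.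
  (* If the head rejected [e] from the whole union, [plott_irrelevant] would put [e] in [S ord0],
     which the head selects. *)
  apply/orP; left; apply: contraT => eN.
  have DS := greedy_head (pD ord0) gS SX.
  have S0S : S ord0 \subset \bigcup_j S j by apply: bigcup_sup.
  have DeS := plott_irrelevant (pD ord0) eSX S0S DS eN.
  have e0 : e \in S ord0 by rewrite DeS in eD.
  by move: eN; rewrite (setUidPr _) ?DS ?e0 // sub1set (subsetP S0S).
have eS0 : e \notin S ord0.
  by apply: contra eN => eS; rewrite (setUidPr _) ?sub1set // gS.1.
have De : D ord0 (e |: \bigcup_j S j) = S ord0.
  apply: (plott_reject (pD ord0) eSX); last 1 first.
  - move=> x; rewrite setDUl (greedy_headD gS) !inE.
    case: eqP => [-> //|_] /=; rewrite andbF /=; exact: greedy_head_reject.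
  - by apply: subset_trans (subsetUr _ _); apply: bigcup_sup.
  - exact: gS.1.
have restE : (e |: \bigcup_j S j) :\: S ord0 = e |: \bigcup_j S (lift ord0 j).
  rewrite setDUl (greedy_headD gS); congr (_ :|: _).
  by apply/setP=> x; rewrite !inE; case: eqP => [->|]; rewrite ?eS0 ?andbF.
rewrite De (negbTE eS0) restE IHn //; first last.
- by apply: subset_trans eSX; rewrite bigcup_lift setUS ?subsetUr.
- exact: greedy_tail.
apply/existsP/existsP=> -[j ej]; first by exists (lift ord0 j).
case: (unliftP ord0 j) ej => [j' ->|->] ej; first by exists j'.
by rewrite ej in eN.
Qed.

(** The heads agree, both being the first factor's selection from the common union; removing them
    leaves a common union of the tails. *)
Lemma greedy_uniq n (D : 'I_n -> {set T} -> {set T}) S S' :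
  (forall j, plott X (D j)) -> greedy D S -> greedy D S' ->
  \bigcup_j S j \subset X -> \bigcup_j S j = \bigcup_j S' j -> S =1 S'.
Proof.
elim: n D S S' => [|n IHn] D S S' pD gS gS' SX eqS j; first by case: j.
have eq0 : S ord0 = S' ord0.
  by rewrite -(greedy_head (pD _) gS) // eqS (greedy_head (pD _) gS') // -eqS.
case: (unliftP ord0 j) => [j' ->|-> //].
apply: (IHn _ _ _ (fun i => pD (lift ord0 i)) (greedy_tail gS) (greedy_tail gS')).
  by apply: subset_trans SX; rewrite bigcup_lift subsetUr.
by rewrite -(greedy_headD gS) -(greedy_headD gS') eqS eq0.
Qed.

Lemma cf_prod_subset n (D : 'I_n -> {set T} -> {set T}) A :
  (forall j, plott X (D j)) -> A \subset X -> cf_prod D A \subset A.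
Proof.
elim: n D A => [|n IHn] D A pD AX; first by rewrite big_ord0 sub0set.
have [cD _ _] := pD ord0.
rewrite big_ord_recl subUset cD //= (subset_trans (IHn _ _ _ _)) ?subsetDl //.
by rewrite (subset_trans _ AX) ?subsetDl.
Qed.

(** What [D j] picks from [A] is either taken by an earlier factor or, by substitutability, still
    picked from the smaller set that remains. *)
Lemma cf_prod_factor n (D : 'I_n -> {set T} -> {set T}) A j :
  (forall j, plott X (D j)) -> A \subset X -> D j A \subset cf_prod D A.
Proof.
elim: n D A j => [|n IHn] D A j pD AX; first by case: j.
rewrite big_ord_recl /cf_star.
case: (unliftP ord0 j) => [j' ->|->]; last exact: subsetUl.
set B := A :\: _; have BA : B \subset A by apply: subsetDl.
have [cD _ sD] := pD (lift ord0 j').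
apply/subsetP=> e eD; rewrite inE; case: (boolP (e \in D ord0 A)) => //= e0.
apply: (subsetP (IHn (fun i => D (lift ord0 i)) B j' _ _)) => //.
  exact: subset_trans AX.
by apply: (subsetP (sD A B AX BA)); rewrite !inE eD e0 (subsetP (cD _ AX)).
Qed.

Lemma greedy_exists n (D : 'I_n -> {set T} -> {set T}) A :
  (forall j, plott X (D j)) -> A \subset X -> cf_prod D A = A ->
  exists2 S, greedy D S & \bigcup_j S j = A.
Proof.
elim: n D A => [|n IHn] D A pD AX.
  by rewrite big_ord0 => <-; exists (fun=> set0); rewrite ?big_ord0 //; split=> -[].
rewrite big_ord_recl /cf_star; set S0 := D ord0 A => prodA.
have pD' j : plott X (D (lift ord0 j)) by [].
have AX' : A :\: S0 \subset X by rewrite (subset_trans _ AX) ?subsetDl.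
have [|S gS cupS] := IHn _ _ pD' AX'.
  (* The tail selects within [A :\: S0], so removing [S0] from both sides of [prodA] shows that it
     selects all of [A :\: S0]. *)
  rewrite -{2}prodA setDUl setDv set0U; apply/esym/setDidPl.
  rewrite disjoint_sym; apply: disjointWr (cf_prod_subset pD' AX') _.
  by rewrite -setI_eq0 setIDA setIC -setIDA setDv setI0.
have [cD kD _] := pD ord0.
exists (fun i => if unlift ord0 i is Some i' then S i' else S0); last first.
  rewrite bigcup_lift unlift_none; under eq_bigr do rewrite liftK.
  by rewrite cupS -[X in X :|: _](setIidPr (cD _ AX)) setID.
split=> [j|j k].
  case: unliftP => [j' ->|->]; first exact: gS.1.
  by apply: kD => //; apply: cD.
case: (unliftP ord0 k) => [k' ->|-> //] jk e eS.
case: (unliftP ord0 j) jk => [j' ->|->] jk; first exact: (gS.2 j' k').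
have: e \in A :\: S0 by rewrite -cupS; apply/bigcupP; exists k'.
rewrite inE => /andP[eN eA].
(* By consistency the head selects [S0] from [e |: S0], which lies between [S0] and [A]. *)
rewrite (kD A (e |: S0)) ?subsetUr // subUset sub1set eA; exact: cD.
Qed.

End Plott.

(** * Lifting a choice function along a map, with ties broken by rank *)

Section TieBreak.

Variables (T' T : finType) (f : T' -> T) (rank : T' -> nat).
Implicit Types (A B : {set T'}) (C : {set T} -> {set T}) (X : {set T}).

(** Elements of equal least rank in a fibre are all kept. Where [f] is injective there are no ties
    and this is [C] transported along [f]; thus one construction serves the agents of both sides. *)
Definition tie_break C A := [set x in A | (f x \in C (f @: A)) &&
  [forall y in A, (f y == f x) ==> (rank x <= rank y)]].

Lemma tie_breakP C A x :
  reflect [/\ x \in A, f x \in C (f @: A) & {in A, forall y, f y = f x -> rank x <= rank y}]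
    (x \in tie_break C A).
Proof.
rewrite inE; apply: (iffP and3P) => -[xA xC /= h]; split=> //.
  by move=> y yA yx; move/forall_inP: h => /(_ y yA); rewrite yx eqxx.
by apply/forall_inP=> y yA; apply/implyP=> /eqP; apply: h.
Qed.

Lemma imset_tie_break X C A : choice_function X C -> f @: A \subset X ->
  f @: tie_break C A = C (f @: A).
Proof.
move=> cC AX; apply/setP=> e; apply/imsetP/idP=> [[x /tie_breakP[_ xC _] ->] // | eC].
have /imsetP[x0 x0A ex0] := subsetP (cC _ AX) _ eC.
have Px0 : (x0 \in A) && (f x0 == e) by rewrite x0A ex0 eqxx.
case: (arg_minnP (P := [pred x in A | f x == e]) rank Px0) => x /andP[xA /eqP fx] xmin.
exists x => //; apply/tie_breakP; split=> [||y yA]; rewrite ?fx // => fy.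
by apply: xmin; rewrite /= yA fy eqxx.
Qed.

Lemma tie_break_plott X C A : plott X C -> f @: A \subset X -> plott A (tie_break C).
Proof.
move=> [cC kC sC] AX.
have subX B : B \subset A -> f @: B \subset X.
  by move=> BA; apply: subset_trans AX; apply: imsetS.
split=> [B BA|B B' BA CB' B'B|B B' BA B'B].
- by apply/subsetP=> x /tie_breakP[].
- have eC : C (f @: B') = C (f @: B).
    apply: kC; rewrite ?subX ?imsetS //.
    by rewrite -(imset_tie_break cC) ?subX ?imsetS.
  apply/setP=> x; apply/tie_breakP/tie_breakP=> -[xB xC xmin]; last first.
    rewrite eC; split=> // [|y /(subsetP B'B)]; last exact: xmin.
    by apply: (subsetP CB'); apply/tie_breakP.
  rewrite eC in xC; split=> // [|y yB fy]; first exact: (subsetP B'B).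
  (* A least-rank [z] over [f x] is selected from [B], hence lies in [B'], so minimality of [x] in
     [B'] carries over to [B]. *)
  have := xC; rewrite -(imset_tie_break cC) ?subX // => /imsetP[z zC xz].
  have /tie_breakP[_ _ zmin] := zC.
  by apply: leq_trans (xmin z _ _) (zmin y yB _); rewrite ?(subsetP CB') ?fy.
- apply/subsetP=> x /setIP[/tie_breakP[xB xC xmin] xB'].
  apply/tie_breakP; split=> // [|y /(subsetP B'B)]; last exact: xmin.
  apply: (subsetP (sC (f @: B) _ _ _)); rewrite ?subX ?imsetS //.
  by rewrite inE xC imset_f.
Qed.

Lemma tie_break_fix X C A : choice_function X C -> f @: A \subset X ->
  tie_break C A = A <->
  C (f @: A) = f @: A /\ {in A &, forall x y, f x = f y -> rank x <= rank y}.
Proof.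
move=> cC AX; split=> [fixA|[fixA rankA]].
  split=> [|x y xA yA fxy]; first by rewrite -(imset_tie_break cC) ?fixA.
  by have := xA; rewrite -{1}fixA => /tie_breakP[_ _]; apply.
apply/setP=> x; apply/tie_breakP/idP=> [[] //|xA].
by split=> // [|y yA fyx]; rewrite ?fixA ?imset_f //; apply: rankA.
Qed.

End TieBreak.

Lemma stableP (J : problem) (S : {set contract J}) :
  reflect ((forall a, choice a (S :&: contracts_of a) = S :&: contracts_of a) /\
           (forall e, {in part e, forall a, e \in choice a (e |: (S :&: contracts_of a))} ->
              e \in S))
    (S \in stable J).
Proof.
rewrite inE; apply: (iffP andP) => -[fixS noblock]; split.
- by move=> a; apply/eqP/(forallP fixS).
- move=> e eS; apply: (implyP (forallP noblock e)).
  by apply/forall_inP=> a ae; rewrite setUC eS.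
- by apply/forallP=> a; apply/eqP.
- apply/forallP=> e; apply/implyP=> /forall_inP eS; apply: noblock => a ae.
  by rewrite setUC eS.
Qed.

(** * Construction of the expanded problem *)

Section Expansion.

Variables (I : problem) (M W : {set agent I}) (q : agent I -> nat).
Variable D : forall w : agent I, 'I_(q w) -> {set contract I} -> {set contract I}.
(** Left open because two cases differ: it will be the set of contracts without participants in [W]
    if [M] is nonempty, and the unique stable set of [I] if [M] is empty. *)
Variable V : {set contract I}.
Hypothesis cover_MW : M :|: W = [set: agent I].
Hypothesis disj_MW : [disjoint M & W].
Hypothesis D_plott : forall w : agent I, w \in W ->
  forall j : 'I_(q w), plott (contracts_of w) (D j).

Definition slot : finType := {w : agent I & 'I_(q w)}.

Definition xagent : finType := ({m : agent I | m \in M} + {u : slot | tag u \in W})%type.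

(* (e, Some w(j)) is the copy of e for w(j); (e, None), for e in V, is a
   contract without participants from W. *)
Definition valid (x : contract I * option slot) : bool :=
  if x.2 is Some u then tag u \in W :&: part x.1 else x.1 \in V.

Definition xcontract : finType := {x : contract I * option slot | valid x}.

Definition piN (a : xagent) : agent I :=
  match a with inl m => val m | inr u => tag (val u) end.

Definition piE (x : xcontract) : contract I := (val x).1.

Definition owner (x : xcontract) : option slot := (val x).2.

Definition rank (x : xcontract) : nat := if owner x is Some u then tagged u else 0.

Definition xpart (x : xcontract) : {set xagent} :=
  [set a | match a with
           | inl m => val m \in part (piE x)
           | inr u => owner x == Some (val u)
           end].

Definition base_choice (a : xagent) : {set contract I} -> {set contract I} :=
  match a with inl m => choice (val m) | inr u => D (tagged (val u)) end.

Definition xchoice (a : xagent) := tie_break piE rank (base_choice a).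

Definition xof (a : xagent) : {set xcontract} := [set x | a \in xpart x].

Lemma base_plott a : plott (contracts_of (piN a)) (base_choice a).
Proof. by case: a => [m|[u Wu]]; [apply: choice_plott | apply: D_plott]. Qed.

Lemma piE_xof a : piE @: xof a \subset contracts_of (piN a).
Proof.
apply/subsetP=> _ /imsetP[x + ->]; rewrite !inE.
case: a => [m|u] //= /eqP ox; have := valP x.
by rewrite /valid -/(owner x) ox inE => /andP[].
Qed.

Lemma xchoice_plott a : plott (xof a) (xchoice a).
Proof. exact: tie_break_plott (base_plott a) (piE_xof a). Qed.

Definition expansion : problem := Problem xchoice_plott.

Lemma copy_subproof (w : agent I) : w \notin W -> w \in M.
Proof. by have := in_setT w; rewrite -cover_MW inE orbC; case: (w \in W). Qed.

(* The value w at an agent w outside W is junk. *)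
Definition copy (w : agent I) (j : 'I_(q w)) : xagent :=
  match boolP (w \in W) with
  | AltTrue Ww => inr (exist _ (Tagged (fun w => 'I_(q w)) j : slot) Ww)
  | AltFalse Ww => inl (exist _ w (copy_subproof Ww))
  end.

Lemma copyE w j (Ww : w \in W) : @copy w j =
  inr (exist (fun u : slot => tag u \in W) (Tagged (fun w => 'I_(q w)) j) Ww).
Proof.
rewrite /copy; case: {-}_ / boolP => [Ww'|Mw]; last by have := Mw; rewrite Ww.
by congr (inr (exist _ _ _)); apply: bool_irrelevance.
Qed.

Definition xM : {set xagent} := [set a | if a is inl _ then true else false].

Lemma piN_M : maps_bijectively piN xM M.
Proof.
split; first by move=> [m|u] [m'|u']; rewrite ?inE //= => _ _ /val_inj ->.
apply/setP=> m; apply/imsetP/idP=> [[[[m' Mm]|u] + ->]|Mm]; rewrite ?inE //.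
by exists (inl (exist _ m Mm)); rewrite ?inE.
Qed.

Lemma copy_inj w : w \in W -> injective (@copy w).
Proof.
move=> Ww j j'; rewrite !(copyE _ Ww).
move/(congr1 (fun a => if a is inr u then val u == Tagged (fun w => 'I_(q w)) j' else false)).
by rewrite /= eqxx eq_Tagged => /eqP.
Qed.

Lemma piN_copy w : w \in W -> piN @^-1: [set w] = [set @copy w j | j : 'I_(q w)].
Proof.
move=> Ww; apply/setP=> a; rewrite !inE; apply/eqP/imsetP=> [|[j _ ->]]; last first.
  by rewrite (copyE _ Ww).
case: a => [[m Mm] /= mw|[[w' j] Ww'] /= eqw].
  by case/negP: (negbT (disjointFl disj_MW Ww)); rewrite -mw.
by subst w'; exists j; rewrite // (copyE _ Ww').
Qed.

Lemma piN_xW w : w \in W -> piN @^-1: [set w] \subset ~: xM.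
Proof.
move=> Ww; rewrite piN_copy //; apply/subsetP=> _ /imsetP[j _ ->].
by rewrite (copyE _ Ww) !inE.
Qed.

Lemma piE_copy w j : w \in W ->
  maps_bijectively piE (xof (@copy w j)) (contracts_of w).
Proof.
move=> Ww; rewrite (copyE _ Ww); split=> [x y|].
  rewrite !inE /owner => /eqP ox /eqP oy exy; apply/val_inj.
  by rewrite [val x]surjective_pairing [val y]surjective_pairing ox oy -/(piE x) exy.
apply/setP=> e; apply/imsetP/idP=> [[x xP ->]|].
  by apply: (subsetP (piE_xof _)) (imset_f piE xP).
rewrite inE => we.
have Px : tag (Tagged (fun w => 'I_(q w)) j : slot) \in W :&: part e by rewrite inE Ww.
by exists (exist _ (e, Some (Tagged _ j)) Px); rewrite ?inE //= /owner.
Qed.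

Lemma xchoice_copy w j : w \in W -> forall A : {set xcontract}, A \subset xof (@copy w j) ->
  piE @: xchoice (@copy w j) A = D j (piE @: A).
Proof.
move=> Ww A AX; rewrite (copyE _ Ww) in AX *.
have [cC _ _] := base_plott (inr (exist _ (Tagged _ j : slot) Ww)).
by rewrite (imset_tie_break _ cC) // (subset_trans (imsetS _ AX)) ?piE_xof.
Qed.

(** Clauses (a) and (b) hold by construction whatever [V] is; only the bijection of stable sets
    remains to be supplied. *)
Lemma expansion_spec : maps_bijectively (fun S : {set contract expansion} => piE @: S)
    (stable expansion) (stable I) ->
  exists (I' : problem) (M' W' : {set agent I'})
         (piN : agent I' -> agent I) (piE : contract I' -> contract I)
         (copy : forall w : agent I, 'I_(q w) -> agent I'),
    (M' :|: W' = [set: agent I'] /\ [disjoint M' & W'])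
    /\ (maps_bijectively piN M' M
        /\ forall w : agent I, w \in W ->
             [/\ injective (copy w),
                 piN @^-1: [set w] = [set copy w j | j : 'I_(q w)]
               & piN @^-1: [set w] \subset W'])
    /\ (forall w : agent I, w \in W -> forall j : 'I_(q w),
          maps_bijectively piE (contracts_of (copy w j)) (contracts_of w)
          /\ forall A : {set contract I'}, A \subset contracts_of (copy w j) ->
               piE @: choice (copy w j) A = D j (piE @: A))
    /\ maps_bijectively (fun S : {set contract I'} => piE @: S)
         (stable I') (stable I).
Proof.
move=> bijSt; exists expansion, xM, (~: xM), piN, piE, copy.
split; first by rewrite setUCr -setI_eq0 setICr.
split; first by split=> [|w Ww]; [apply: piN_M | split;
  [apply: copy_inj | apply: piN_copy | apply: piN_xW]].
by split=> // w Ww j; split; [apply: piE_copy | apply: xchoice_copy].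
Qed.
Lemma piE_owner_inj x y : piE x = piE y -> owner x = owner y -> x = y.
Proof.
move=> exy oxy; apply/val_inj; rewrite [val x]surjective_pairing [val y]surjective_pairing.
by rewrite -/(piE x) -/(owner x) exy oxy.
Qed.

Lemma in_xof_copy w j x : w \in W ->
  (x \in xof (@copy w j)) = (owner x == Some (Tagged (fun w => 'I_(q w)) j)).
Proof. by move=> Ww; rewrite (copyE _ Ww) !inE. Qed.

Lemma base_choice_copy w j : w \in W -> base_choice (@copy w j) = D j.
Proof. by move=> Ww; rewrite (copyE _ Ww). Qed.

Lemma in_xof_inl m x : (x \in xof (inl m)) = (piE x \in contracts_of (val m)).
Proof. by rewrite !inE. Qed.

Lemma xagent_ind (P : xagent -> Prop) :
  (forall m, P (inl m)) -> (forall w j, w \in W -> P (@copy w j)) -> forall a, P a.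
Proof.
move=> Pinl Pcopy [m|[[w j] Ww]]; first exact: Pinl.
by move: (Pcopy w j Ww); rewrite (copyE j Ww).
Qed.

Lemma piE_restrict (S : {set xcontract}) m :
  piE @: (S :&: xof (inl m)) = (piE @: S) :&: contracts_of (val m).
Proof.
apply/setP=> e; apply/imsetP/setIP => [[x /setIP[xS xm] ->]|[/imsetP[x xS ->] xm]].
  by rewrite imset_f // -in_xof_inl.
by exists x => //; rewrite inE xS in_xof_inl.
Qed.

Lemma xchoice_add a (S : {set xcontract}) x :
  reflect (piE x \in base_choice a (piE x |: piE @: (S :&: xof a)) /\
           {in S :&: xof a, forall y, piE y = piE x -> rank x <= rank y})
    (x \in xchoice a (x |: (S :&: xof a))).
Proof.
apply: (iffP (tie_breakP _ _ _ _ _)); rewrite imsetU1.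
  by move=> [_ xD xmin]; split=> // y yS; apply: xmin; rewrite in_setU1 yS orbT.
move=> [xD xmin]; split=> //; first exact: setU11.
by move=> y; rewrite in_setU1 => /predU1P[->|] //; apply: xmin.
Qed.

(** The candidate for the set [S j] of a greedy decomposition at [w]. *)
Definition slice (S : {set xcontract}) w (j : 'I_(q w)) : {set contract I} :=
  piE @: (S :&: xof (@copy w j)).

Lemma in_slice (S : {set xcontract}) w (j : 'I_(q w)) x : w \in W ->
  owner x = Some (Tagged (fun w => 'I_(q w)) j) -> (piE x \in slice S j) = (x \in S).
Proof.
move=> Ww ox; apply/imsetP/idP=> [[y /setIP[yS]]|xS]; last first.
  by exists x => //; rewrite inE xS in_xof_copy // ox /=.
by rewrite in_xof_copy // => /eqP oy exy; rewrite (piE_owner_inj exy) // oy.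
Qed.

Lemma sliceP (S : {set xcontract}) w (j : 'I_(q w)) e : w \in W ->
  reflect (exists x, [/\ x \in S, owner x = Some (Tagged (fun w => 'I_(q w)) j) & e = piE x])
    (e \in slice S j).
Proof.
move=> Ww; apply: (iffP imsetP) => [[x /setIP[xS]]|[x [xS ox ->]]].
  by rewrite in_xof_copy // => /eqP ox ->; exists x.
by exists x; rewrite // inE xS in_xof_copy // ox /=.
Qed.

(** * Stable sets of the expansion when [M] meets every contract *)

Hypothesis W_unconnected : forall e : contract I, #|part e :&: W| <= 1.
Hypothesis choice_W : forall w : agent I, w \in W ->
  forall A : {set contract I}, A \subset contracts_of w ->
    choice w A = (\big[@cf_star (contract I)/@cf0 (contract I)]_(j < q w) D j) A.
Hypothesis V_E : V = [set e | [disjoint part e & W]].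
Hypothesis M_part : forall e : contract I, exists2 m, m \in M & m \in part e.

Lemma W_part_uniq e w w' : w \in W -> w' \in W -> w \in part e -> w' \in part e -> w = w'.
Proof.
move=> Ww Ww' we we'; apply: (card_le1_eqP (W_unconnected e)).
  by rewrite inE we'.
by rewrite inE we.
Qed.

Lemma ownerP x : match owner x with
  | Some u => (tag u \in W) && (tag u \in part (piE x))
  | None => [disjoint part (piE x) & W]
  end.
Proof.
have := valP x; rewrite /valid -/(owner x) -/(piE x) V_E.
by case: (owner x) => [u|]; rewrite inE.
Qed.

Variant same_contract_spec (x y : xcontract) : Prop :=
  | SameFree of owner x = None & owner y = None
  | SameCopies w (j k : 'I_(q w)) of w \in W & w \in part (piE x) &
      owner x = Some (Tagged (fun w => 'I_(q w)) j) &
      owner y = Some (Tagged (fun w => 'I_(q w)) k).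

(** [W_unconnected] leaves one possible agent of [W] for the owners, and [V_E] gives an ownerless
    copy only to contracts without such an agent. *)
Lemma same_contractP x y : piE x = piE y -> same_contract_spec x y.
Proof.
move=> exy; have := ownerP x; have := ownerP y; rewrite -exy.
case ox: (owner x) => [[w j]|]; case oy: (owner y) => [[w' k]|] //=.
- move=> /andP[Ww' we'] /andP[Ww we].
  have eqw := W_part_uniq Ww Ww' we we'; subst w'.
  exact: (@SameCopies _ _ w j k).
- by move=> dis /andP[Ww we]; rewrite (disjointFr dis we) in Ww.
- by move=> /andP[Ww we] dis; rewrite (disjointFr dis we) in Ww.
- by move=> _ _; apply: SameFree.
Qed.

(** Owned copies of one contract share their agent and differ only in the index, which is the rank;
    an ownerless copy is the only one of its contract. *)
Lemma rank_inj x y : piE x = piE y -> rank x = rank y -> x = y.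
Proof.
move=> exy rxy; apply: piE_owner_inj => //.
have [-> ->//|w j k _ _ ox oy] := same_contractP exy.
by move: rxy; rewrite /rank ox oy /= => /val_inj ->.
Qed.

Lemma slice_sub (S : {set xcontract}) w (j : 'I_(q w)) : w \in W ->
  slice S j \subset contracts_of w.
Proof.
move=> Ww; apply/subsetP=> _ /(sliceP _ _ _ Ww)[x [_ ox ->]].
by have := ownerP x; rewrite ox inE => /andP[].
Qed.

Lemma bigcup_slice (S : {set xcontract}) w : w \in W ->
  \bigcup_(j < q w) slice S j = (piE @: S) :&: contracts_of w.
Proof.
move=> Ww; apply/setP=> e; apply/bigcupP/setIP => [[j _ eS]|].
  rewrite (subsetP (slice_sub _ _ Ww) _ eS); split=> //.
  by have /(sliceP _ _ _ Ww)[x [xS _ ->]] := eS; apply: imset_f.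
move=> [/imsetP[x xS ->]]; rewrite inE => we; have := ownerP x.
case ox: (owner x) => [[w' j]|] /=; last by move=> dis; rewrite (disjointFr dis we) in Ww.
move=> /andP[Ww' we']; have eqw := W_part_uniq Ww Ww' we we'; subst w'.
by exists j => //; rewrite (in_slice _ Ww ox).
Qed.

Lemma bigcup_slice_sub (S : {set xcontract}) w : w \in W ->
  \bigcup_(j < q w) slice S j \subset contracts_of w.
Proof. by move=> Ww; rewrite bigcup_slice // subsetIr. Qed.

Lemma xchoice_fix a (S : {set xcontract}) :
  xchoice a (S :&: xof a) = S :&: xof a <->
  base_choice a (piE @: (S :&: xof a)) = piE @: (S :&: xof a) /\
  {in S :&: xof a &, forall x y, piE x = piE y -> rank x <= rank y}.
Proof.
have [cC _ _] := base_plott a; apply: tie_break_fix cC _.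
by apply: subset_trans (piE_xof a); rewrite imsetS ?subsetIr.
Qed.

(** Greediness determines, through [greedy_prod] and [greedy_prod_add], how [C_w] acts on the
    projection, so the stability conditions of the two problems can be compared contract by
    contract. *)
Lemma greedy_stable (S : {set xcontract}) : {in S &, injective piE} ->
  {in W, forall w, greedy (@D w) (@slice S w)} ->
  (S \in stable expansion) = (piE @: S \in stable I).
Proof.
move=> injS gS.
have prodS w : w \in W -> choice w ((piE @: S) :&: contracts_of w) = (piE @: S) :&: contracts_of w.
  move=> Ww; rewrite choice_W ?subsetIr // -bigcup_slice //.
  by apply: (greedy_prod (D_plott Ww)); [apply: gS | apply: bigcup_slice_sub].
have addS w e : w \in W -> w \in part e ->
  (e \in choice w (e |: ((piE @: S) :&: contracts_of w))) =
  [exists j, e \in D j (e |: @slice S w j)].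
  move=> Ww we; have eSX : e |: ((piE @: S) :&: contracts_of w) \subset contracts_of w.
    by rewrite subUset sub1set inE we subsetIr.
  rewrite choice_W // -bigcup_slice //; apply: (greedy_prod_add (D_plott Ww)); first exact: gS.
  by rewrite bigcup_slice.
apply/stableP/stableP=> -[fixS noblock]; split.
- move=> a; have := in_setT a; rewrite -cover_MW inE => /orP[Ma|]; last exact: prodS.
  have /xchoice_fix[] := fixS (inl (exist _ a Ma)).
  by rewrite piE_restrict.
- move=> e eS; apply: contraT => eNS.
  suff [x ex xS] : exists2 x, piE x = e &
      {in xpart x, forall a, x \in xchoice a (x |: (S :&: xof a))}.
    by rewrite -ex imset_f ?noblock in eNS.
  (* Since [e] is outside the projection of [S], no copy of it competes and the tie condition is
     vacuous. *)
  have xM_choice (x : xcontract) m : piE x = e -> val m \in part e ->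
      x \in xchoice (inl m) (x |: (S :&: xof (inl m))).
    move=> ex me; apply/xchoice_add; split; first by rewrite piE_restrict ex eS.
    by move=> y /setIP[yS _] exy; rewrite -ex -exy imset_f in eNS.
  have [eV|/pred0Pn[w /andP[/= we Ww]]] := boolP [disjoint part e & W].
    have Px : valid (e, None) by rewrite /valid V_E inE.
    exists (exist _ (e, None) Px) => // -[m|u]; rewrite inE //.
    exact: xM_choice.
  (* [C_w] accepts [e], so some factor does; the copy of [e] for that factor is the required [x]. *)
  have /existsP[j ej] : [exists j, e \in D j (e |: @slice S w j)] by rewrite -addS ?eS.
  have Px : valid (e, Some (Tagged (fun w => 'I_(q w)) j)) by rewrite /valid /= inE Ww.
  exists (exist _ (e, Some (Tagged (fun w => 'I_(q w)) j)) Px) => //.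
  elim/xagent_ind=> [m|w' k Ww']; rewrite inE; first exact: xM_choice.
  rewrite {1}(copyE _ Ww') /= => /eqP[eqw]; subst w'.
  move=> /eqP; rewrite eq_Tagged => /eqP <- {k}.
  apply/xchoice_add; rewrite base_choice_copy //; split=> // y.
  by move=> /setIP[yS _] exy; rewrite -[e]exy imset_f in eNS.
- elim/xagent_ind=> [m|w j Ww]; apply/xchoice_fix.
    rewrite piE_restrict; split; first exact: fixS.
    by move=> x y /setIP[xS _] /setIP[yS _] exy; rewrite (injS _ _ xS yS exy).
  rewrite base_choice_copy //; split; first exact: (gS w Ww).1.
  by move=> x y /setIP[xS _] /setIP[yS _] exy; rewrite (injS _ _ xS yS exy).
- move=> x chosen.
  have chosenM m : val m \in part (piE x) -> x \in xchoice (inl m) (x |: (S :&: xof (inl m))).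
    by move=> me; apply: chosen; rewrite inE.
  have chosenW w (j : 'I_(q w)) : w \in W ->
      owner x = Some (Tagged (fun w => 'I_(q w)) j) -> piE x \in D j (piE x |: @slice S w j).
    move=> Ww ox; have /xchoice_add[] : x \in xchoice (copy j) (x |: (S :&: xof (copy j))).
      by apply: chosen; have := in_xof_copy j x Ww; rewrite inE ox eqxx.
    by rewrite base_choice_copy.
  (* An agent of [M] prefers [x] to any copy [y] of the same contract in [S] of larger rank, and
     accepts [x] only if no such [y] has smaller rank. *)
  have [m Mm me] := M_part (piE x).
  have /xchoice_add[_ xmin] := chosenM (exist _ m Mm) me.
  have : piE x \in piE @: S.
    apply: noblock => a ax; have := in_setT a; rewrite -cover_MW inE => /orP[Ma|Wa].
      by have /xchoice_add[+ _] := chosenM (exist _ a Ma) ax; rewrite piE_restrict.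
    have := ownerP x; case ox: (owner x) => [[w j]|] /=; last first.
      by move=> dis; rewrite (disjointFr dis ax) in Wa.
    move=> /andP[Ww we]; have eqw := W_part_uniq Wa Ww ax we; subst w.
    by rewrite addS //; apply/existsP; exists j; apply: chosenW.
  move=> /imsetP[y yS exy].
  have := xmin y; rewrite inE yS in_xof_inl inE -exy => /(_ me erefl).
  rewrite leq_eqVlt => /predU1P[rxy|xy].
    by rewrite (rank_inj exy rxy).
  have [ox oy|w j k Ww we ox oy] := same_contractP exy; first by rewrite /rank ox oy in xy.
  (* Here [y] belongs to a later factor [k], so greediness makes factor [j] reject the contract that
     it accepts as owner of [x]. *)
  suff: piE x \notin D j (piE x |: slice S j) by rewrite chosenW.
  have jk : j < k by move: xy; rewrite /rank ox oy.
  by apply: ((gS w Ww).2 j k jk); rewrite exy (in_slice _ Ww oy).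
Qed.

(** An agent of [M] in the contract keeps only copies of least rank, and the rank separates
    copies. *)
Lemma stable_piE_inj (S : {set xcontract}) : S \in stable expansion ->
  {in S &, injective piE}.
Proof.
move=> /stableP[fixS _] x y xS yS exy; have [m Mm me] := M_part (piE x).
pose a : xagent := inl (exist _ m Mm).
have xa : x \in S :&: xof a by rewrite inE xS in_xof_inl inE.
have ya : y \in S :&: xof a by rewrite inE yS in_xof_inl inE -exy.
have /xchoice_fix[_ rankS] := fixS a.
by apply: rank_inj => //; apply/eqP; rewrite eqn_leq !rankS.
Qed.

(* The members of M prefer the copy of smallest index, so w(j) alone can, and
   hence does, reject a contract signed by a later copy of w. *)
Lemma stable_greedy (S : {set xcontract}) : S \in stable expansion ->
  {in W, forall w, greedy (@D w) (@slice S w)}.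
Proof.
move=> stS; have injS := stable_piE_inj stS.
move/stableP: stS => [fixS noblock] w Ww; split=> [j|j k jk e].
  by have /xchoice_fix[] := fixS (copy j); rewrite base_choice_copy.
move=> /(sliceP _ _ _ Ww)[y [yS oy ey]]; apply/negP=> eD.
have we : w \in part e by have := ownerP y; rewrite oy -ey => /andP[].
have Px : valid (e, Some (Tagged (fun w => 'I_(q w)) j)) by rewrite /valid /= inE Ww.
pose x : xcontract := exist _ (e, Some (Tagged (fun w => 'I_(q w)) j)) Px.
have ox : owner x = Some (Tagged (fun w => 'I_(q w)) j) by [].
have exy : piE x = piE y by [].
have rxy : rank x < rank y by rewrite /rank ox oy.
(* [x] would be a second copy of [e] in [S] besides [y]; it remains to see that all its participants
   accept it. *)
suff xS : x \in S by rewrite (injS _ _ xS yS exy) ltnn in rxy.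
apply: noblock; elim/xagent_ind=> [m|w' k' Ww'] ax; apply/xchoice_add.
  have me : piE y \in contracts_of (val m) by rewrite inE in ax; rewrite inE -exy.
  split=> [|z /setIP[zS _] ezx]; last first.
    by rewrite (injS _ _ zS yS) ?ezx // ltnW.
  (* The agent of [M] already signs [y], so its choice function accepts the underlying contract. *)
  have /xchoice_fix[+ _] := fixS (inl m); rewrite exy /=.
  rewrite (setUidPr _) ?sub1set piE_restrict; last by rewrite inE imset_f.
  by move=> ->; rewrite inE imset_f.
have : x \in xof (copy k') by rewrite inE.
rewrite in_xof_copy // ox => /eqP[eqw]; subst w'.
move=> /eqP; rewrite eq_Tagged => /eqP <- {k' ax}.
(* All contracts of [w(j)] have rank [j]. *)
rewrite base_choice_copy //; split=> // z /setIP[_].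
by rewrite in_xof_copy // => /eqP oz _; rewrite /rank ox oz.
Qed.

(** Injectivity comes from uniqueness of greedy decompositions; surjectivity comes from their
    existence, applied at each [w] and glued. *)
Lemma expansion_bij : maps_bijectively (fun S : {set contract expansion} => piE @: S)
  (stable expansion) (stable I).
Proof.
split=> [S S' stS stS' eqS|].
  have sub S1 S2 : S1 \in stable expansion -> S2 \in stable expansion ->
      piE @: S1 = piE @: S2 -> S1 \subset S2.
    move=> st1 st2 eq12; apply/subsetP=> x x1.
    have /imsetP[y y2 exy] : piE x \in piE @: S2 by rewrite -eq12 imset_f.
    have [ox oy|w j k Ww we ox oy] := same_contractP exy.
      by rewrite (piE_owner_inj exy) // ox.
    rewrite -(in_slice _ Ww ox) -(greedy_uniq (D_plott Ww) (stable_greedy st1 Ww)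
      (stable_greedy st2 Ww)) ?bigcup_slice_sub ?(in_slice _ Ww ox) //.
    by rewrite !bigcup_slice // eq12.
  by apply/eqP; rewrite eqEsubset !sub.
apply/setP=> S; apply/imsetP/idP=> [[S' stS' ->]|stS].
  by rewrite -greedy_stable //; [apply: stable_piE_inj | apply: stable_greedy].
have /fin_all_exists[F FP] : forall w, exists Sw : 'I_(q w) -> {set contract I},
    w \in W -> greedy (@D w) Sw /\ \bigcup_j Sw j = S :&: contracts_of w.
  move=> w; have [Ww|Ww] := boolP (w \in W); last by exists (fun=> set0).
  have /stableP[fixS _] := stS.
  have [||Sw gSw cupSw] := greedy_exists (A := S :&: contracts_of w) (D_plott Ww).
  - exact: subsetIr.
  - by rewrite -choice_W ?subsetIr.
  by exists Sw.
have FS w (j : 'I_(q w)) : w \in W -> F w j \subset S :&: contracts_of w.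
  by move=> Ww; have [_ <-] := FP w Ww; apply: bigcup_sup.
pose S' : {set xcontract} := [set x |
  if owner x is Some u then piE x \in F (tag u) (tagged u) else piE x \in S].
have sliceE w (j : 'I_(q w)) : w \in W -> slice S' j = F w j.
  move=> Ww; apply/setP=> e; apply/(sliceP _ _ _ Ww)/idP => [[x [+ ox ->]]|eF].
    by rewrite inE ox.
  have := subsetP (FS w j Ww) e eF; rewrite !inE => /andP[eS we].
  have Px : valid (e, Some (Tagged (fun w => 'I_(q w)) j)) by rewrite /valid /= inE Ww.
  by exists (exist _ (e, Some (Tagged (fun w => 'I_(q w)) j)) Px); rewrite inE.
have gS' : {in W, forall w, greedy (@D w) (@slice S' w)}.
  move=> w Ww; have [[fixF rejF] _] := FP w Ww.
  by split=> [j|j k jk e]; rewrite !sliceE //; apply: rejF.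
have injS' : {in S' &, injective piE}.
  move=> x y xS yS exy; apply: rank_inj => //.
  have [ox oy|w j k Ww we ox oy] := same_contractP exy; first by rewrite /rank ox oy.
  have ej : piE x \in slice S' j by rewrite (in_slice _ Ww ox).
  have ek : piE x \in slice S' k by rewrite exy (in_slice _ Ww oy).
  (* A contract in an earlier set is chosen there, so greediness keeps it out of the later ones. *)
  have disj (i l : 'I_(q w)) : i < l -> piE x \in slice S' i -> piE x \notin @slice S' w l.
    move=> il ei; apply/negP=> /((gS' w Ww).2 i l il).
    by rewrite (setUidPr _) ?sub1set // (gS' w Ww).1 ei.
  rewrite /rank ox oy /=; case: (ltngtP j k) => // [jk|kj].
    by have := disj _ _ jk ej; rewrite ek.
  by have := disj _ _ kj ek; rewrite ej.
have piS' : piE @: S' = S.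
  apply/setP=> e; apply/imsetP/idP=> [[x + ->]|eS].
    rewrite inE; have := ownerP x; case: (owner x) => [[w j] /= /andP[Ww _]|] //.
    by move/(subsetP (FS w j Ww)); rewrite inE => /andP[].
  have [eV|/pred0Pn[w /andP[/= we Ww]]] := boolP [disjoint part e & W].
    have Px : valid (e, None) by rewrite /valid V_E inE.
    by exists (exist _ (e, None) Px); rewrite ?inE.
  have : e \in \bigcup_j F w j by rewrite (FP w Ww).2 !inE eS.
  case/bigcupP=> j _; rewrite -sliceE // => /(sliceP _ _ _ Ww)[x [xS _ ->]].
  by exists x.
by exists S' => //; rewrite greedy_stable // piS'.
Qed.

End Expansion.

(** * The case of an empty [M] *)

(** Distinct agents share no contract, so each must hold exactly its choice from all its contracts;
    contracts without participants belong by vacuity. *)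
Lemma stable_unconnected (J : problem) : (forall e : contract J, #|part e| <= 1) ->
  stable J = [set [set e | [forall a in part e, e \in choice a (contracts_of a)]]].
Proof.
move=> part1; set S0 := [set e | _].
have part_eq e (a b : agent J) : a \in part e -> b \in part e -> a = b.
  by move=> ae be; apply: (card_le1_eqP (part1 e)).
have S0E a : S0 :&: contracts_of a = choice a (contracts_of a).
  have [cC _ _] := choice_plott a.
  apply/setP=> e; rewrite !inE; apply/andP/idP=> [[/forall_inP eC ae]|eC]; first exact: eC.
  have ae : a \in part e by have := subsetP (cC _ (subxx _)) e eC; rewrite inE.
  by split=> //; apply/forall_inP=> b be; rewrite (part_eq _ _ _ be ae).
apply/setP=> S; rewrite in_set1; apply/idP/eqP=> [/stableP[fixS noblock]|->].
  have choiceE a : choice a (contracts_of a) = S :&: contracts_of a.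
    apply: (plott_reject (choice_plott a) (subxx _) (subsetIr _ _)) => // e.
    rewrite !inE => /andP[+ ae]; rewrite ae andbT; apply: contra => eC.
    by apply: noblock => b be; rewrite (part_eq _ _ _ be ae).
  apply/setP=> e; rewrite inE; apply/idP/forall_inP=> [eS a ae|eC].
    by rewrite choiceE !inE eS.
  apply: noblock => a ae; have eX : e |: S :&: contracts_of a \subset contracts_of a.
    by rewrite subUset sub1set inE ae subsetIr.
  (* By substitutability, a contract chosen from all contracts of [a] is also chosen from the
     smaller set. *)
  apply: contraLR (eC a ae) => eN.
  exact: plott_inter_reject (choice_plott a) (subxx _) eX (setU11 _ _) eN.
apply/stableP; split=> [a|e eC]; rewrite ?S0E.
  by have [cC kC _] := choice_plott a; apply: kC => //; apply: cC.
rewrite inE; apply/forall_inP=> a ae; have := eC a ae; rewrite S0E.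
have [cC kC _] := choice_plott a.
rewrite (kC (contracts_of a)) ?subsetUr //.
by rewrite subUset sub1set inE ae cC.
Qed.

(* Without M, nothing prevents two copies of a contract from being signed
   together; but then stable sets are unique, and the participant-free contracts
   (e, None), which belong to every stable set, make the projections agree. *)
Lemma expansion_bij_set0 (I : problem) (M W : {set agent I}) (q : agent I -> nat)
    (D : forall w : agent I, 'I_(q w) -> {set contract I} -> {set contract I})
    (cover_MW : M :|: W = [set: agent I]) (disj_MW : [disjoint M & W])
    (D_plott : forall w : agent I, w \in W ->
       forall j : 'I_(q w), plott (contracts_of w) (D w j)) :
  M = set0 ->
  (forall e : contract I, #|part e :&: W| <= 1) ->
  (forall w : agent I, w \in W ->
     forall A : {set contract I}, A \subset contracts_of w ->
       choice w A = cf_prod (@D w) A) ->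
  maps_bijectively
    (fun S : {set contract (expansion M
       [set e | [forall a in part e, e \in choice a (contracts_of a)]] D_plott)} =>
       (@piE _ _ _ _) @: S)
    (stable _) (stable I).
Proof.
move=> M0 W_unconnected choice_W; set V := [set e | _].
have WT : W = setT by rewrite -cover_MW M0 set0U.
have part1 (e : contract I) : #|part e| <= 1 by have := W_unconnected e; rewrite WT setIT.
have noM (m : {m | m \in M}) : False by case: m => m; rewrite M0 inE.
rewrite !stable_unconnected //; last first.
  (* With [M] empty, a participant of a copy can only be its owner. *)
  move=> x; apply/card_le1_eqP=> -[m|u]; first by case: (noM m).
  case=> [m|u']; first by case: (noM m).
  by rewrite !inE => /eqP -> /eqP[] /val_inj ->.
set S0 := [set x | _]; split; first by move=> S S'; rewrite !inE => /eqP-> /eqP->.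
rewrite imset_set1; congr [set _]; apply/setP=> e; apply/imsetP/idP=> [[x xS ->]|eV].
  case ox: (owner x) => [[w j]|]; last first.
    by have := valP x; rewrite /valid -/(owner x) ox.
  have := valP x; rewrite /valid -/(owner x) ox /= in_setI => /andP[Ww we].
  have xa : x \in @xof _ M W q V (copy cover_MW j) by rewrite in_xof_copy // ox /=.
  (* The owner [w(j)] chooses [x] from all its contracts, which project onto [E(w)];
     [cf_prod_factor] then passes from the factor to [C_w]. *)
  have : x \in xchoice D (copy cover_MW j) (@xof _ M W q V (copy cover_MW j)).
    by move: xS; rewrite inE => /forall_inP; apply; rewrite inE in xa.
  case/tie_breakP=> _ + _; rewrite base_choice_copy // (piE_copy V cover_MW j Ww).2 => xD.
  rewrite inE; apply/forall_inP=> a ae.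
  rewrite (card_le1_eqP (part1 (piE x)) w a we ae) choice_W //.
  exact: (subsetP (cf_prod_factor j (D_plott _ Ww) (subxx _))).
have Px : valid W V (e, None : option (slot q)) by [].
exists (exist _ (e, None) Px) => //; rewrite inE; apply/forall_inP=> -[m|u].
  by case: (noM m).
by rewrite inE.
Qed.

(** * Adding an agent to all contracts *)

(** The choice splits into [C] inside [X] and the identity outside, and each piece has the three
    properties. *)
Lemma plott_indifferent (T : finType) (X Y : {set T}) C : plott X C ->
  plott Y (fun A => C (A :&: X) :|: (A :\: X)).
Proof.
move=> [cC kC sC]; split=> [A _|A B _ CB BA|A B _ BA].
- rewrite subUset subsetDl andbT.
  exact: subset_trans (cC _ (subsetIr _ _)) (subsetIl _ _).
- move: CB; rewrite subUset => /andP[CB DB]; congr (_ :|: _).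
    apply: kC; rewrite ?subsetIr ?setSI // subsetI CB.
    exact: subset_trans (cC _ (subsetIr _ _)) (subsetIr _ _).
  apply/eqP; rewrite eqEsubset setSD //= subsetD DB /=.
  by rewrite -setI_eq0 setIC setIDA setIC setDIl setDv setI0.
- apply/subsetP=> x; rewrite !inE => /andP[/orP[xC|/andP[xX xA]] xB]; last first.
    by rewrite xX xB orbT.
  have xX : x \in X.
    by have := subsetP (cC _ (subsetIr _ _)) x xC; rewrite inE => /andP[].
  apply/orP; left; apply: (subsetP (sC _ _ (subsetIr A X) (setSI X BA))).
  by rewrite !inE xC xB.
Qed.

Section Guest.

Variables (I : problem) (m : agent I).

Definition guest_choice (a : agent I) (A : {set contract I}) :=
  if a == m then choice m (A :&: contracts_of m) :|: (A :\: contracts_of m)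
  else choice a A.

Lemma guest_contracts a : a != m -> [set e | a \in m |: part e] = contracts_of a.
Proof. by move=> am; apply/setP=> e; rewrite !inE (negbTE am). Qed.

Lemma guest_choice_plott a : plott [set e | a \in m |: part e] (guest_choice a).
Proof.
rewrite /guest_choice; have [->|am] := eqVneq a m.
  exact/plott_indifferent/choice_plott.
by rewrite guest_contracts //; apply: choice_plott.
Qed.

Definition guest : problem := Problem guest_choice_plott.

Lemma guest_contracts_of_m : @contracts_of guest m = setT.
Proof. by apply/setP=> e; rewrite !inE eqxx. Qed.

(** [m] accepts every contract new to it, so such contracts neither break its fixed-point condition
    nor are vetoed by it. *)
Lemma stable_guest : stable guest = stable I.
Proof.
have fixE (S : {set contract I}) :
    (choice m (S :&: contracts_of m) :|: S :\: contracts_of m == S) =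
    (choice m (S :&: contracts_of m) == S :&: contracts_of m).
  have [cC _ _] := choice_plott m; have := cC _ (subsetIr S (contracts_of m)).
  set X := contracts_of m; set B := choice m _ => BS.
  apply/eqP/eqP=> [<-|->]; last exact: setID.
  rewrite setIUl setIDAC setDIl setDv setI0 setU0; apply/esym/setIidPl.
  exact: subset_trans BS (subsetIr _ _).
apply/setP=> S; apply/(@stableP guest S)/(@stableP I S) => -[fixS noblock]; split.
- move=> a; have := fixS a; rewrite /= /guest_choice; have [->|am] := eqVneq a m.
    by rewrite guest_contracts_of_m setIT => /eqP; rewrite fixE => /eqP.
  by rewrite [contracts_of (a : agent guest)]guest_contracts.
- move=> e eC; apply: noblock => a; rewrite /= /guest_choice.
  have [->|am] := eqVneq a m; last first.
    by rewrite in_setU1 (negbTE am) [contracts_of (a : agent guest)]guest_contracts //; apply: eC.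
  move=> _; rewrite guest_contracts_of_m setIT !inE eqxx.
  have [me|] /= := boolP (m \in part e); last by rewrite orbT.
  by rewrite setIUl (setIidPl _) ?sub1set ?inE ?eC.
- move=> a; rewrite /= /guest_choice; have [->|am] := eqVneq a m.
    by rewrite guest_contracts_of_m setIT; apply/eqP; rewrite fixE; apply/eqP.
  by rewrite [contracts_of (a : agent guest)]guest_contracts.
- move=> e eC; apply: noblock => a ae.
  have /eC : a \in @part guest e by rewrite in_setU1 ae orbT.
  rewrite /= /guest_choice; have [eam _|am] := eqVneq a m; last first.
    by rewrite [contracts_of (a : agent guest)]guest_contracts.
  have : e \in guest_choice m (e |: S).
    by have := eC m (setU11 _ _); rewrite guest_contracts_of_m setIT.
  rewrite eam in ae *; rewrite /guest_choice eqxx !inE ae /= orbF.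
  by rewrite setIUl (setIidPl _) ?sub1set ?inE.
Qed.

End Guest.

Theorem theorem3 (I : problem) (M W : {set agent I})
    (q : agent I -> nat)
    (D : forall w : agent I, 'I_(q w) -> {set contract I} -> {set contract I})
    (cover_MW : M :|: W = [set: agent I])
    (disj_MW : [disjoint M & W])
    (W_unconnected : forall e : contract I, #|part e :&: W| <= 1)
    (D_plott : forall w : agent I, w \in W ->
       forall j : 'I_(q w), plott (contracts_of w) (D w j))
    (choice_W : forall w : agent I, w \in W ->
       forall A : {set contract I}, A \subset contracts_of w ->
         choice w A = (\big[@cf_star (contract I)/@cf0 (contract I)]_(j < q w) D w j) A) :
  exists (I' : problem) (M' W' : {set agent I'})
         (piN : agent I' -> agent I) (piE : contract I' -> contract I)
         (copy : forall w : agent I, 'I_(q w) -> agent I'),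
    (M' :|: W' = [set: agent I'] /\ [disjoint M' & W'])
    /\ (maps_bijectively piN M' M
        /\ forall w : agent I, w \in W ->
             [/\ injective (copy w),
                 piN @^-1: [set w] = [set copy w j | j : 'I_(q w)]
               & piN @^-1: [set w] \subset W'])
    /\ (forall w : agent I, w \in W -> forall j : 'I_(q w),
          maps_bijectively piE (contracts_of (copy w j)) (contracts_of w)
          /\ forall A : {set contract I'}, A \subset contracts_of (copy w j) ->
               piE @: choice (copy w j) A = D w j (piE @: A))
    /\ maps_bijectively (fun S : {set contract I'} => piE @: S)
         (stable I') (stable I).
Proof.
have [M0|[m Mm]] := set_0Vmem M.
  (* Unification takes for [V] the unique stable set of [I]. *)
  apply: (expansion_spec cover_MW disj_MW (D_plott := D_plott)).
  exact: expansion_bij_set0 cover_MW disj_MW D_plott M0 W_unconnected choice_W.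
(* As [m] is outside [W], passing to [guest m] changes neither the contracts nor the choices of
   agents of [W]. *)
have Wm w : w \in W -> w != m.
  by move=> Ww; apply: contraTneq Ww => ->; rewrite (disjointFr disj_MW Mm).
have WE w : w \in W -> @contracts_of (guest m) w = contracts_of w.
  by move=> Ww; rewrite -(guest_contracts (Wm w Ww)).
have D_plott' (w : agent (guest m)) : w \in W ->
    forall j : 'I_(q w), plott (@contracts_of (guest m) w) (D w j).
  by move=> Ww; rewrite WE //; apply: D_plott.
have [|||I' [M' [W' [piN [piE [copy [HMW [HN [HE HS]]]]]]]]] :=
  @expansion_spec (guest m) M W q D _ cover_MW disj_MW D_plott'
    (expansion_bij (I := guest m) (V := [set e | [disjoint @part (guest m) e & W]])
       cover_MW D_plott' _ _ erefl _).
- move=> e; rewrite /= setIUl (_ : [set m] :&: W = set0) ?set0U //.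
  by apply/setP=> a; rewrite !inE; case: eqP => // ->; rewrite (disjointFr disj_MW Mm).
- move=> w Ww A; rewrite WE // => AX.
  by rewrite /= /guest_choice (negbTE (Wm w Ww)); apply: choice_W.
- by move=> e; exists m => //; apply: setU11.
exists I', M', W', piN, piE, copy; split=> //; split=> //; split.
  by move=> w Ww j; rewrite -WE //; apply: HE.
by rewrite -(stable_guest m).
Qed.
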